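(* Let $\mathcal{P}_{2,1}$ be the set of odd primes $p$ with $p\equiv1\pmod4$ such that the order $s$ of $2$ in $(\mathbb{Z}/p\mathbb{Z})^*$ equals $\frac{p-1}{2}$. Only finitely many prime numbers $p\in\mathcal{P}_{2,1}$ give rise to the inequality $\beta>1/2$. There is only one such prime number: $p=17$.
   Context: $\eta_n=(-1)^{s_2(n)}$ for $n\ge0$, where $s_2(n)$ is the sum of the binary digits of $n$. For an odd prime $p$ and $i\in\mathbb{Z}/p\mathbb{Z}$, the $p$-rarefied sum is $S_{p,i}(n)=\sum_{0\le j<n,\ j\equiv i\,(\mathrm{mod}\,p)}\eta_j$. With $s$ the order of $2$ in $(\mathbb{Z}/p\mathbb{Z})^*$, $\lambda_1$ denotes the largest modulus of an eigenvalue of the $p\times p$ matrix $M=(S_{p,i-j}(2^s))_{0\le i,j\le p-1}$ (indices $i-j$ taken mod $p$), and $\beta=\beta(p)=\frac{\log\lambda_1}{s\log2}$. *)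

(* Defs.v *)
From HB Require Import structures.
From mathcomp Require Import all_boot all_order all_algebra all_fingroup.
From mathcomp Require Import all_classical all_reals all_analysis.
From mathcomp Require Export complex.

Set Implicit Arguments.
Unset Strict Implicit.
Unset Printing Implicit Defensive.

Import Order.TTheory GRing.Theory Num.Theory.

Local Open Scope ring_scope.

(* Since n < 2 ^ n, all the nonzero binary digits of n have index below n. *)
Definition binary_digit_sum (n : nat) : nat :=
  (\sum_(i < n) (n %/ 2 ^ i) %% 2)%N.

Definition eta (n : nat) : int := (-1) ^+ binary_digit_sum n.

(* The class i of Z/pZ is given by any natural number representing it. *)
Definition rarefied_sum (p i n : nat) : int :=
  \sum_(0 <= j < n | j == i %[mod p]) eta j.

(* The default value 1 of insubd is used only when 2 is not a unit of 'Z_p;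
   recall that 'Z_p is Z/pZ only for 1 < p. *)
Definition order_of_2 (p : nat) : nat :=
  #[insubd (1%g : {unit 'Z_p}) (2%:R : 'Z_p)]%g.

(* i + p - j is a natural number representing the class of i - j mod p. *)
Definition rarefied_mx (p : nat) : 'M[int]_p :=
  \matrix_(i < p, j < p) rarefied_sum p (i + p - j) (2 ^ order_of_2 p).

(* The set of moduli is finite, so its supremum is a maximum (it is nonempty
   when 0 < p). *)
Definition lambda1 (R : realType) (p : nat) : R :=
  sup [set ComplexField.Normc.normc z | z in
        [set z : R[i] | eigenvalue (map_mx intr (rarefied_mx p)) z]]%classic.

Definition beta (R : realType) (p : nat) : R :=
  ln (lambda1 R p) / ((order_of_2 p)%:R * ln 2).

Definition P21 : set nat :=
  [set p | [/\ prime p, odd p, p = 1 %[mod 4] & order_of_2 p = (p.-1)./2]]%classic.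

(* Main.v *)
(** The matrix is circulant and sum_(j < 2 ^ s) eta_j x ^ j is the product of the
    1 - x ^ (2 ^ t), t < s, so the eigenvalues are these products G(x) at the p-th
    roots of unity x, and beta > 1/2 means that |G(x)| ^ 2 > 2 ^ s for some x.

    On the unit circle |1 - y| ^ 2 = 2 (1 - Re y), and
    1 + u <= exp (u - 2 / 7 u ^ 2) for u in [-1, 1].  As squaring permutes the
    powers x ^ (2 ^ t), this gives
    |G(x)| ^ 2 <= 2 ^ s exp (- s / 7 - 8 / 7 C), with C the sum of the
    Re x ^ (2 ^ t).  When s = (p - 1) / 2, Parseval's identity gives
    (2 C + 1) ^ 2 <= p, hence |G(x)| ^ 2 <= 2 ^ s as soon as p >= 81.

    The remaining primes are 17 and 41.  The sum of |G(x)| ^ 2 over all x is p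
    times the sum of the squared coefficients of G modulo X ^ p - 1, and |G| is
    constant on the orbits of squaring, so that computing these coefficients
    bounds the maximum of |G| below for p = 17 and above for p = 41. *)
Require Import Defs.
From mathcomp Require Import all_boot all_order all_algebra.
From mathcomp Require Import all_classical all_reals all_analysis.
From mathcomp Require Import all_fingroup cyclic zify ring lra.

Set Implicit Arguments.
Unset Strict Implicit.
Unset Printing Implicit Defensive.

Import Order.TTheory GRing.Theory Num.Theory.

Local Open Scope classical_set_scope.
Local Open Scope ring_scope.

Local Notation normc := ComplexField.Normc.normc.

(** * The order of 2 modulo p *)

Lemma val_Zp2X (p k : nat) : (1 < p)%N ->
  val ((2%:R : 'Z_p) ^+ k) = (2 ^ k %% p)%N.
Proof. by move=> p1; rewrite -natrX /= val_Zp_nat. Qed.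

Lemma order_of_2_dvd (p k : nat) : (1 < p)%N -> odd p ->
  (order_of_2 p %| k)%N = (2 ^ k == 1 %[mod p])%N.
Proof.
move=> p1 op; rewrite /order_of_2 order_dvdn -val_eqE FinRing.val_unitX /=.
rewrite insubdK; last by rewrite -topredE /= unitZpE // coprimen2.
by rewrite -val_eqE /= val_Zp2X // -(val_Zp_nat p1 1).
Qed.

Lemma eq_exp2_mod_order (p i j : nat) : (1 < p)%N -> odd p ->
  (i < order_of_2 p)%N -> (j < order_of_2 p)%N ->
  2 ^ i = 2 ^ j %[mod p] -> i = j.
Proof.
move=> p1 op; wlog le_ij : i j / (i <= j)%N => [hw|] lti ltj.
  by case: (leqP i j) => [/hw|/ltnW /hw h e]; [exact|rewrite h].
move=> /eqP; rewrite eq_sym eqn_mod_dvd ?leq_exp2l //.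
rewrite -{1}(subnK le_ij) expnD -{2}(mul1n (2 ^ i)%N) -mulnBl.
rewrite Gauss_dvdl ?coprimeXr ?coprimen2 // -eqn_mod_dvd ?expn_gt0 //.
rewrite -order_of_2_dvd // /dvdn modn_small; first by lia.
exact: leq_ltn_trans (leq_subr _ _) ltj.
Qed.

(** * Binary digits and the generating product of [eta] *)

Lemma binary_digit_sumE (m n : nat) : (n <= m)%N ->
  binary_digit_sum n = (\sum_(i < m) (n %/ 2 ^ i) %% 2)%N.
Proof.
move=> le_nm; rewrite /binary_digit_sum -(subnKC le_nm) big_split_ord /=.
rewrite [X in (_ + X)%N]big1 ?addn0 // => i _.
by rewrite divn_small // (leq_trans (ltn_expl n (ltnSn 1))) // leq_pexp2l // leq_addr.
Qed.

Lemma binary_digit_sum_bound (m n : nat) : (n < 2 ^ m)%N ->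
  binary_digit_sum n = (\sum_(i < m) (n %/ 2 ^ i) %% 2)%N.
Proof.
move=> lt_nm; rewrite (binary_digit_sumE (leq_addl m n)) big_split_ord /=.
rewrite [X in (_ + X)%N]big1 ?addn0 // => i _.
by rewrite divn_small // (leq_trans lt_nm) // leq_pexp2l // leq_addr.
Qed.

Lemma eta_add_exp2 (s j : nat) : (j < 2 ^ s)%N -> eta (2 ^ s + j) = - eta j.
Proof.
move=> lt_j; rewrite /eta (binary_digit_sum_bound lt_j).
rewrite (@binary_digit_sum_bound s.+1); last by rewrite expnS mul2n -addnn ltn_add2l.
rewrite big_ord_recr /= divnDl // divnn expn_gt0 /= divn_small // addn0.
rewrite modn_small // exprD expr1 mulrN1; congr (- (_ ^+ _)); apply: eq_bigr => i _.
(* After division by [2 ^ i] with [i < s], the new leading bit contributes an even number, so digit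
   [i] is unchanged. *)
have -> : (2 ^ s = 2 ^ (s - i.+1) * 2 * 2 ^ i)%N.
  by rewrite -expnSr -expnD; congr (2 ^ _)%N; have := ltn_ord i; lia.
by rewrite divnMDl ?expn_gt0 // modnMDl.
Qed.

(** By induction on [s]: since [eta] changes sign under adding [2 ^ s], the upper half of the range
    contributes [- x ^+ (2 ^ s)] times the lower half. *)
Lemma sum_eta_expr (F : comNzRingType) (s : nat) (x : F) :
  \sum_(j < 2 ^ s) (eta j)%:~R * x ^+ j = \prod_(t < s) (1 - x ^+ (2 ^ t)).
Proof.
elim: s => [|s IH].
  by rewrite big_ord1 big_ord0 /eta /binary_digit_sum big_ord0 mulr1.
rewrite big_ord_recr /= -IH -(big_mkord predT (fun j => (eta j)%:~R * x ^+ j)).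
rewrite expnS mul2n -addnn (big_cat_nat (leq0n _) (leq_addr _ _)) /=.
rewrite -{2}(add0n (2 ^ s)%N) big_addn addnK !big_mkord mulrBr mulr1; congr (_ + _).
rewrite mulr_suml -sumrN; apply: eq_bigr => j _.
by rewrite addnC eta_add_exp2 // rmorphN mulNr exprD -mulrA (mulrC (x ^+ j)).
Qed.

(** * Orthogonality of roots of unity and Parseval's identity *)

Lemma sum_prim_root (F : fieldType) (n : nat) (w : F) (d : nat) :
  n.-primitive_root w ->
  \sum_(k < n) w ^+ (d * k) = if (n %| d)%N then n%:R else 0.
Proof.
move=> prim_w; rewrite (prim_order_dvd prim_w).
under eq_bigr do rewrite exprM.
case: eqP => [->|/eqP wd1].
  by under eq_bigr do rewrite expr1n; rewrite sumr_const card_ord.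
apply/eqP; move: (subrX1 (w ^+ d) n).
rewrite -exprM mulnC exprM (prim_expr_order prim_w) expr1n subrr => /esym/eqP.
by rewrite mulf_eq0 subr_eq0 (negPf wd1).
Qed.

Lemma prim_root_natr_neq0 (F : fieldType) (n : nat) (w : F) :
  n.-primitive_root w -> n%:R != 0 :> F.
Proof. by move=> prim_w; rewrite (prim_root_dvd_eq0 prim_w). Qed.

Lemma prim_root_neq0 (F : fieldType) (n : nat) (w : F) :
  n.-primitive_root w -> w != 0.
Proof.
move=> prim_w; rewrite -unitfE -(unitrX_pos w (prim_order_gt0 prim_w)).
by rewrite (prim_expr_order prim_w) unitr1.
Qed.

(** Powers of [w] have modulus 1, so conjugation inverts them. The inverse of [w ^+ e] is written
    [w ^+ (n - e)] to keep exponents natural; orthogonality then leaves only the terms with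
    [d = e]. *)
Lemma parseval (C : numClosedFieldType) (n : nat) (w : C) (c : 'I_n -> C) :
  n.-primitive_root w ->
  \sum_(k < n) `|\sum_(d < n) c d * w ^+ (d * k)| ^+ 2
  = n%:R * \sum_(d < n) `|c d| ^+ 2.
Proof.
move=> prim_w; have n0 := prim_order_gt0 prim_w.
have wn1 := prim_expr_order prim_w.
have w0 := prim_root_neq0 prim_w.
have conjw m : (w ^+ m)^* = (w ^+ m)^-1.
  rewrite -(mul1r (w ^+ m)^-1) -[1](expr1n _ 2) -[X in X ^+ 2](_ : `|w ^+ m| = 1).
    by rewrite normCK mulrC mulKf // expf_neq0.
  apply/eqP; rewrite -(@pexpr_eq1 _ _ n) // -normrX -exprM mulnC exprM wn1.
  by rewrite expr1n normr1.
transitivity (\sum_(k < n) \sum_(d < n) \sum_(e < n)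
    c d * (c e)^* * w ^+ ((d + (n - e)) * k)).
  apply: eq_bigr => k _; rewrite normCK rmorph_sum mulr_suml.
  apply: eq_bigr => d _; rewrite mulr_sumr; apply: eq_bigr => e _.
  rewrite rmorphM /= conjw mulrACA; congr (_ * _).
  rewrite mulnDl exprD; congr (_ * _); apply: (@mulIf _ (w ^+ (e * k))).
    by rewrite expf_neq0.
  rewrite mulVf ?expf_neq0 // -exprD -mulnDl subnK ?(ltnW (ltn_ord e)) //.
  by rewrite exprM wn1 expr1n.
rewrite exchange_big mulr_sumr; apply: eq_bigr => d _ /=.
rewrite exchange_big (bigD1 d) //= [X in _ + X]big1 => [|e ne].
  rewrite addr0 -mulr_sumr sum_prim_root // subnKC ?(ltnW (ltn_ord d)) //.
  by rewrite dvdnn normCK mulrC.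
rewrite -mulr_sumr sum_prim_root // ifF ?mulr0 //.
(* As [0 < d + (n - e) < 2 n], divisibility by [n] forces the quotient 1, that is [d = e]. *)
apply: contraNF ne => /dvdnP[q hq]; apply/eqP/val_inj => /=.
have := ltn_ord d; have := ltn_ord e.
by case: q hq => [|[|q]]; rewrite ?mulSn; lia.
Qed.

(** * Circulant matrices and the discrete Fourier transform *)

Definition cyc_sub (n : nat) (i j : 'I_n) : 'I_n :=
  Ordinal (ltn_pmod (i + n - j) (leq_ltn_trans (leq0n i) (ltn_ord i))).

Lemma cyc_subP (n : nat) (i j : 'I_n) : cyc_sub i j + j = i %[mod n].
Proof.
rewrite /= modnDml subnK ?modnDr //.
by apply: leq_trans (leq_addl _ _); apply: ltnW.
Qed.

Lemma cyc_subK (n : nat) (i : 'I_n) : involutive (cyc_sub i).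
Proof.
move=> j; apply/val_inj; have /eqP := cyc_subP i (cyc_sub i j).
rewrite -(cyc_subP i j) [X in (X == _ %[mod _])%N]addnC eqn_modDl.
by rewrite !modn_small ?ltn_ord // => /eqP.
Qed.

Lemma cyc_sub_inj (n : nat) (j : 'I_n) : injective (fun i : 'I_n => cyc_sub i j).
Proof.
move=> i i' /= e; apply/val_inj => /=.
have := cyc_subP i j; rewrite e cyc_subP.
by rewrite !modn_small ?ltn_ord.
Qed.

Section Circulant.
Variables (F : fieldType) (n : nat) (w : F) (f : nat -> F).
Hypotheses (prim_w : n.-primitive_root w) (f_mod : forall m, f (m %% n) = f m).

Let A : 'M[F]_n := \matrix_(i < n, j < n) f (i + n - j).

(** The characters [i |-> w ^+ (i * k)] are row eigenvectors. Conversely, the Fourier transform [u]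
    of an eigenvector turns the action of [A] into multiplication by the sums on the right, so any
    [k] with [u k != 0] identifies [z]. *)
Lemma eigenvalue_circulant (z : F) :
  eigenvalue A z <-> exists k : 'I_n, z = \sum_(d < n) f d * w ^+ (d * k).
Proof.
have n0 := prim_order_gt0 prim_w.
have w0 := prim_root_neq0 prim_w.
have wk k (i j : 'I_n) : w ^+ (i * k) = w ^+ (j * k) * w ^+ (cyc_sub i j * k).
  rewrite -exprD -mulnDl !(mulnC _ k) !exprM; apply/eqP.
  rewrite -!exprM !(mulnC k) !exprM -!exprM (eq_prim_root_expr prim_w).
  by rewrite -modnMml -(cyc_subP i j) modnMml addnC.
have Af i j : A i j = f (cyc_sub i j) by rewrite mxE -f_mod.
split=> [/eigenvalueP[v vA v0]|[k ->]].
- pose u k := \sum_(i < n) v 0 i * (w ^+ (i * k))^-1.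
  have zu k : z * u k = u k * \sum_(d < n) f d * w ^+ (d * k).
    transitivity (\sum_(j < n) \sum_(i < n) v 0 i * A i j * (w ^+ (j * k))^-1).
      rewrite mulr_sumr; apply: eq_bigr => j _; rewrite -mulr_suml mulrA.
      by congr (_ * _); move/matrixP: vA => /(_ 0 j); rewrite !mxE.
    rewrite exchange_big mulr_suml; apply: eq_bigr => i _ /=.
    rewrite mulr_sumr (reindex_inj (can_inj (cyc_subK i))) /=.
    apply: eq_bigr => d _; rewrite Af cyc_subK (wk k i (cyc_sub i d)) cyc_subK.
    by field; rewrite !expf_neq0.
  (* Fourier inversion: the sum of the [u k * w ^+ (j * k)] is [n] times [v 0 j], and [n] is nonzero
     in [F]. *)
  have [k uk0] : exists k : 'I_n, u k != 0.
    apply: contrapT => u0; move/eqP: v0; apply; apply/rowP => j; rewrite mxE.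
    have : \sum_(k < n) u k * w ^+ (j * k) = 0.
      apply: big1 => k _; apply/eqP; rewrite mulf_eq0; apply/orP; left.
      by apply: contrapT => /negP uk; apply: u0; exists k.
    under eq_bigr do rewrite mulr_suml.
    rewrite exchange_big (bigD1 j) //= [X in _ + X]big1 => [|i ne].
      under eq_bigr do rewrite divfK ?expf_neq0 //.
      rewrite addr0 sumr_const card_ord -mulr_natr => /eqP.
      by rewrite mulf_eq0 (negPf (prim_root_natr_neq0 prim_w)) orbF => /eqP.
    under eq_bigr do rewrite (wk _ j i) -mulrA (mulrA _^-1) mulVf ?expf_neq0 // mul1r.
    rewrite -mulr_sumr sum_prim_root // ifF ?mulr0 //.
    apply: contraNF ne => /eqP; rewrite modn_small ?ltn_ord // => e.
    have := cyc_subP j i; rewrite e add0n !modn_small ?ltn_ord // => /val_inj.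
    by move=> ->.
  exists k; apply: (mulfI uk0); rewrite -zu mulrC //.
- apply/eigenvalueP; exists (\row_i w ^+ (i * k)).
    apply/rowP => j; rewrite !mxE mulr_suml [RHS](reindex_inj (@cyc_sub_inj n j)) /=.
    apply: eq_bigr => i _; rewrite Af mxE (wk k i j) /=.
    ring.
  apply/eqP => /rowP/(_ (Ordinal n0)); rewrite !mxE mul0n expr0 => /eqP.
  by rewrite oner_eq0.
Qed.

End Circulant.

(** * A quadratic refinement of 1 + u <= exp u *)

Section RealAnalysis.
Variable R : realType.
Implicit Types u y : R.

Lemma expR_ge_quadratic y : 0 <= y -> 1 + y + y ^+ 2 / 2 <= expR y.
Proof.
move=> y0; rewrite /expR.
have -> : 1 + y + y ^+ 2 / 2 = series (exp_coeff y) 3.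
  rewrite /series /= !big_nat_recr //= big_nil /exp_coeff /=.
  by rewrite !factS fact0 /= !muln1 expr0 expr1 add0r !divr1.
apply: nondecreasing_cvgn_le; last exact: is_cvg_series_exp_coeff.
by apply: nondecreasing_series => n _ _; exact: exp_coeff_ge0.
Qed.

(** The constant is constrained at [u = 1], where it must not exceed 1 - ln 2 = 0.306...; 2 / 7 lies
    just below. For [u >= 0] the exponential is the square of [expR z], bounded below by its
    quadratic Taylor polynomial; for [u < 0] it is a fourth power, to which 1 + y <= exp y is
    applied. *)
Lemma add1_le_expR_quadratic u : -1 <= u <= 1 ->
  1 + u <= expR (u - 2 / 7 * u ^+ 2).
Proof.
move=> /andP[u1 u2]; case: (leP 0 u) => u0.
- pose q := 1 - 2 / 7 * u; pose z := u * q / 2.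
  have -> : u - 2 / 7 * u ^+ 2 = z + z by rewrite /z /q; field.
  have q0 : 5 / 7 <= q by rewrite /q; lra.
  have z0 : 0 <= z by rewrite /z; apply: divr_ge0 => //; apply: mulr_ge0 => //; lra.
  rewrite expRD -expr2.
  have h := expR_ge_quadratic z0.
  apply: le_trans (_ : (1 + z + z ^+ 2 / 2) ^+ 2 <= _); last first.
    by rewrite lerXn2r // nnegrE ?expR_ge0 //; nra.
  have q3 : 125 / 343 <= q ^+ 3.
    have -> : 125 / 343 = (5 / 7) ^+ 3 :> R by field.
    by rewrite lerXn2r // nnegrE; lra.
  (* This makes the coefficient of [u ^+ 2] nonnegative in the expansion of the square below. *)
  have hq : 2 / 7 <= q ^+ 2 / 2 + u * q ^+ 3 / 8.
    have : u * (125 / 343) <= u * q ^+ 3 by rewrite ler_wpM2l.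
    have -> : q ^+ 2 = 1 - 4 / 7 * u + 4 / 49 * u ^+ 2 by rewrite /q; field.
    nra.
  have -> : (1 + z + z ^+ 2 / 2) ^+ 2 =
      1 + u + (u ^+ 2 * (q ^+ 2 / 2 + u * q ^+ 3 / 8 - 2 / 7) + (z ^+ 2) ^+ 2 / 4).
    by rewrite /z /q; field.
  rewrite -subr_ge0 in hq; rewrite lerDl.
  by rewrite (addr_ge0 (mulr_ge0 (sqr_ge0 u) hq)) ?divr_ge0 ?sqr_ge0.
- have [v uv] : {v | u = - v} by exists (- u); rewrite opprK.
  have v0 : 0 <= v by lra.
  have v1 : v <= 1 by lra.
  have -> : u - 2 / 7 * u ^+ 2 = 4%:R * (- (v / 4) - v ^+ 2 / 14).
    by rewrite uv; field.
  rewrite expRM_natl uv; have h := expR_ge1Dx (- (v / 4) - v ^+ 2 / 14).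
  have vv : v ^+ 2 <= 1 by rewrite expr_le1.
  have [v3 v4] : 0 <= v ^+ 3 /\ 0 <= v ^+ 4 by rewrite !exprn_ge0.
  (* The intermediate term is the second Taylor polynomial of the square root of [1 - v]; the fourth
     power is reached by squaring twice. *)
  have h1 : 1 - v / 2 - v ^+ 2 / 8 <= (1 - v / 4 - v ^+ 2 / 14) ^+ 2.
    have -> : (1 - v / 4 - v ^+ 2 / 14) ^+ 2 = 1 - v / 2 - v ^+ 2 / 7
        + v ^+ 2 / 16 + v ^+ 3 / 28 + v ^+ 4 / 196 by field.
    by have := sqr_ge0 v; lra.
  have h2 : 1 - v <= (1 - v / 2 - v ^+ 2 / 8) ^+ 2.
    have -> : (1 - v / 2 - v ^+ 2 / 8) ^+ 2 = 1 - v + v ^+ 3 / 8 + v ^+ 4 / 64.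
      by field.
    by lra.
  apply: (le_trans h2); apply: (@le_trans _ _ ((1 - v / 4 - v ^+ 2 / 14) ^+ 4)).
    rewrite (exprM _ 2 2) lerXn2r ?nnegrE ?sqr_ge0 //; lra.
  by rewrite addrA in h; rewrite lerXn2r // nnegrE ?expR_ge0; lra.
Qed.
End RealAnalysis.

(** * Primitive roots of unity and complex moduli *)

Lemma exists_prim_root (C : numClosedFieldType) (p : nat) :
  prime p -> exists w : C, p.-primitive_root w.
Proof.
move=> pr_p; have p1 := prime_gt1 pr_p.
(* A root of 1 + X + ... + X ^ (p - 1) has order dividing [p]; the order is not 1, since the value
   at 1 is [p]. *)
have [x] : exists x : C, root (\poly_(i < p) 1) x.
  apply/closed_rootP; rewrite size_poly_eq ?oner_eq0 //.
  by rewrite neq_ltn p1 orbT.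
rewrite /root horner_poly; under eq_bigr do rewrite mul1r.
move=> /eqP sx; have xp : x ^+ p = 1.
  by apply/eqP; rewrite -subr_eq0 subrX1 sx mulr0.
have [m prim_x] := prim_order_exists (prime_gt0 pr_p) xp.
have /primeP[_ dvd_p] := pr_p => /dvd_p /orP[/eqP m1|/eqP mp]; last by exists x; rewrite -mp.
move: prim_x sx; rewrite m1 => /prim_expr_order; rewrite expr1 => ->.
under eq_bigr do rewrite expr1n.
by rewrite sumr_const card_ord => /eqP; rewrite pnatr_eq0 (gtn_eqF (prime_gt0 pr_p)).
Qed.

Section ComplexModulus.
Variable R : realType.
Implicit Types z : R[i].

(** The norm of [R[i]] takes its values in [R[i]]; this links it to the real-valued modulus used in
    [lambda1]. *)
Lemma normr_normc z : `|z| = (normc z)%:C%C.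
Proof. by rewrite normc_def; case: z. Qed.

Lemma sqr_normcE z : normc z ^+ 2 = complex.Re z ^+ 2 + complex.Im z ^+ 2.
Proof.
by apply: complexI; rewrite rmorphXn /= -normr_normc add_Re2_Im2.
Qed.

Lemma normc_ge0 z : 0 <= normc z.
Proof. by case: z => a b; exact: sqrtr_ge0. Qed.

Lemma normc_prod (I : Type) (r : seq I) (F : I -> R[i]) :
  normc (\prod_(i <- r) F i) = \prod_(i <- r) normc (F i).
Proof.
elim/big_ind2: _ => [|x1 x2 y1 y2 <- <-|//]; first exact: ComplexField.Normc.normc1.
exact: ComplexField.Normc.normcM.
Qed.

Lemma normc_unity_root (n : nat) z : (0 < n)%N -> z ^+ n = 1 -> normc z = 1.
Proof.
move=> n0 zn; apply: complexI; rewrite -normr_normc; apply/eqP.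
by rewrite -(@pexpr_eq1 _ _ n) // -normrX zn normr1.
Qed.

Lemma sqr_normc_sub1 z : normc z = 1 -> normc (1 - z) ^+ 2 = 2 - 2 * complex.Re z.
Proof.
move=> z1; have := sqr_normcE z; rewrite (sqr_normcE (1 - z)) z1; case: z {z1} => a b /=.
by rewrite expr1n sub0r sqrrN => h; nra.
Qed.

Lemma Re_sqr z : normc z = 1 -> complex.Re (z ^+ 2) = 2 * complex.Re z ^+ 2 - 1.
Proof.
move=> z1; have := sqr_normcE z; rewrite z1 expr1n; case: z {z1} => a b /=.
by move=> h; rewrite expr2 /=; nra.
Qed.

Lemma Re_sum (I : Type) (r : seq I) (P : pred I) (F : I -> R[i]) :
  complex.Re (\sum_(i <- r | P i) F i) = \sum_(i <- r | P i) complex.Re (F i).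
Proof. by apply: (big_morph (@complex.Re R)) => // -[a b] [c d]. Qed.

Lemma parseval_normc (n : nat) (w : R[i]) (c : 'I_n -> R[i]) :
  n.-primitive_root w ->
  \sum_(k < n) normc (\sum_(d < n) c d * w ^+ (d * k)) ^+ 2
  = n%:R * \sum_(d < n) normc (c d) ^+ 2.
Proof.
move=> prim_w; apply: complexI.
rewrite rmorphM rmorph_nat !rmorph_sum /=.
under eq_bigr do rewrite rmorphXn /= -normr_normc.
under [in RHS]eq_bigr do rewrite rmorphXn /= -normr_normc.
exact: parseval.
Qed.

End ComplexModulus.

(** * Eigenvalues of the rarefied matrix *)

Lemma rarefied_sum_modn (p i n : nat) :
  rarefied_sum p (i %% p) n = rarefied_sum p i n.
Proof. by apply: eq_bigl => j; rewrite modn_mod. Qed.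

Lemma sum_rarefied_sum (F : comNzRingType) (p n : nat) (x : F) :
  (0 < p)%N -> x ^+ p = 1 ->
  \sum_(d < p) (rarefied_sum p d n)%:~R * x ^+ d =
  \sum_(j < n) (eta j)%:~R * x ^+ j.
Proof.
move=> p0 xp; rewrite /rarefied_sum.
under eq_bigr do rewrite big_mkord rmorph_sum mulr_suml big_mkcond.
rewrite exchange_big; apply: eq_bigr => j _ /=.
rewrite (bigD1 (Ordinal (ltn_pmod j p0))) //= modn_mod eqxx big1 ?addr0.
  by rewrite expr_mod.
move=> d ne; rewrite ifF //; apply: contraNF ne => /eqP e.
by rewrite -val_eqE /= e modn_small.
Qed.

Lemma eigenvalue_rarefied_mx (F : fieldType) (p : nat) (w z : F) :
  p.-primitive_root w ->
  eigenvalue (map_mx intr (rarefied_mx p)) z <->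
  exists k : 'I_p, z = \prod_(t < order_of_2 p) (1 - w ^+ (k * 2 ^ t)).
Proof.
move=> prim_w; have p0 := prim_order_gt0 prim_w.
pose f m : F := (rarefied_sum p m (2 ^ order_of_2 p))%:~R.
have -> : map_mx intr (rarefied_mx p) = \matrix_(i < p, j < p) f (i + p - j)%N.
  by apply/matrixP => i j; rewrite !mxE.
rewrite (eigenvalue_circulant prim_w); last by move=> m; rewrite /f rarefied_sum_modn.
have fE k : \sum_(d < p) f d * w ^+ (d * k)
    = \prod_(t < order_of_2 p) (1 - w ^+ (k * 2 ^ t)).
  under eq_bigr do rewrite mulnC exprM.
  rewrite sum_rarefied_sum ?sum_eta_expr //.
    by apply: eq_bigr => t _; rewrite exprM.
  by rewrite -exprM mulnC exprM (prim_expr_order prim_w) expr1n.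
by split=> -[k zk]; exists k; rewrite ?fE // zk fE.
Qed.

Lemma sum_shift (V : zmodType) (s : nat) (a : nat -> V) :
  a s = a 0%N -> \sum_(t < s) a t.+1 = \sum_(t < s) a t.
Proof.
move=> as0; apply: (addrI (a 0%N)).
by rewrite -(big_ord_recl s (fun t => a t)) big_ord_recr /= as0 addrC.
Qed.

(** * Orbits of doubling modulo p *)

Section DoublingOrbit.
Variables (R : realType) (p : nat).
Hypotheses (p1 : (1 < p)%N) (odd_p : odd p).
Let s := order_of_2 p.
Let p0 : (0 < p)%N := ltnW p1.

Definition doubling_orbit (k : nat) (t : 'I_s) : 'I_p :=
  Ordinal (ltn_pmod (k * 2 ^ t) p0).

Lemma doubling_orbit_inj (k : nat) : coprime p k -> injective (doubling_orbit k).
Proof.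
move=> cpk t t' /(congr1 val) /= /eqP; wlog le_tt' : t t' / (t <= t')%N => [hw|].
  by case: (leqP t t') => [/hw h e|/ltnW /hw h]; [exact: h|rewrite eq_sym => /h].
rewrite eq_sym eqn_mod_dvd ?leq_mul2l ?leq_exp2l ?le_tt' ?orbT //.
rewrite -mulnBr Gauss_dvdr // -eqn_mod_dvd ?leq_exp2l // => /eqP e.
by apply/val_inj/(eq_exp2_mod_order p1 odd_p (ltn_ord t) (ltn_ord t'))/esym.
Qed.

Lemma exp2_order_of_2 : 2 ^ s = 1 %[mod p].
Proof. by apply/eqP; rewrite -order_of_2_dvd. Qed.

(** Of the nonnegative terms, only index 0 and the [s] distinct indices in the orbit of [k] are
    kept, and [F] is constant on that orbit. It serves for both the periods and the eigenvalues. *)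
Lemma le_sum_doubling_orbit (F : nat -> R) (k : nat) : coprime p k ->
  (forall i, 0 <= F i) -> (forall i, F (i %% p)%N = F i) ->
  (forall i, F (i * 2)%N = F i) ->
  F 0%N + s%:R * F k <= \sum_(i < p) F i.
Proof.
move=> cpk F0 Fmod F2; have inj := doubling_orbit_inj cpk.
have Fk t : F (doubling_orbit k t) = F k.
  rewrite /= Fmod; elim: {t}(t : nat) => [|t IH]; first by rewrite muln1.
  by rewrite expnSr mulnA F2.
rewrite (bigID [in doubling_orbit k @: [set: 'I_s]%SET]) /= addrC lerD //; last first.
  rewrite (big_imset _ (in2W inj)) /=; under eq_bigr do rewrite Fk.
  by rewrite sumr_const cardsT card_ord mulr_natl.
rewrite (bigD1 (Ordinal p0)) /=; first by rewrite lerDl sumr_ge0.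
apply/imsetP => -[t _ /(congr1 val) /= /esym/eqP].
rewrite -/(dvdn p _) Gauss_dvdr // -(expn0 2) => h.
have : coprime p (2 ^ t) by rewrite coprimeXr // coprimen2.
by rewrite /coprime (gcdn_idPl h) (gtn_eqF p1).
Qed.

End DoublingOrbit.

(** * Gauss periods of the subgroup generated by 2 *)

Section GaussPeriods.
Variables (R : realType) (p : nat) (w : R[i]).
Hypotheses (p1 : (1 < p)%N) (odd_p : odd p) (prim_w : p.-primitive_root w).
Let s := order_of_2 p.

Lemma expr_order_of_2 (k : nat) : w ^+ (k * 2 ^ s) = w ^+ k.
Proof.
apply/eqP; rewrite (eq_prim_root_expr prim_w) -modnMmr.
by rewrite exp2_order_of_2 // modnMmr muln1.
Qed.

Definition gauss_period (k : nat) : R[i] := \sum_(t < s) w ^+ (k * 2 ^ t).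

(** Parseval's identity for the indicator function of the powers of 2 modulo [p], a set of [s]
    elements. *)
Lemma sum_sqr_normc_gauss_period : \sum_(k < p) normc (gauss_period k) ^+ 2 = p%:R * s%:R.
Proof.
pose A := (doubling_orbit p1 1 @: [set: 'I_s]%SET)%SET.
have inj := @doubling_orbit_inj p p1 odd_p 1 (coprimen1 p).
transitivity (p%:R * \sum_(d < p) normc ((d \in A)%:R : R[i]) ^+ 2).
  rewrite -(parseval_normc _ prim_w); apply: eq_bigr => k _; congr (normc _ ^+ 2).
  under [RHS]eq_bigr do rewrite mulr_natl mulrb.
  rewrite -big_mkcond (big_imset _ (in2W inj)) /=.
  rewrite big_mkcond /=; apply: eq_bigr => t _; rewrite inE mul1n.
  by rewrite mulnC (exprM _ _ k) -(prim_expr_mod prim_w (2 ^ t)) -exprM.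
congr (_ * _); transitivity (\sum_(d in A) (1 : R)).
  rewrite [RHS]big_mkcond; apply: eq_bigr => d _; case: (d \in A).
    by rewrite ComplexField.Normc.normc1 expr1n.
  by rewrite ComplexField.Normc.normc0 expr0n.
by rewrite sumr_const card_imset // cardsT card_ord.
Qed.

Lemma sum_gauss_period : \sum_(k < p) gauss_period k = 0.
Proof.
rewrite exchange_big big1 //= => t _.
under eq_bigr do rewrite mulnC.
rewrite sum_prim_root // ifF //; apply/negP => h.
have : coprime p (2 ^ t) by rewrite coprimeXr // coprimen2.
by rewrite /coprime (gcdn_idPl h) (gtn_eqF p1).
Qed.

(* Write C for the real part of the period at k.  The real parts X_i of the
   periods sum to 0, and their squares to at most p s.  In the sum of
   (X_i + 1 + C) ^ 2 over all i, keep only i = 0, where X_i = s, and the s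
   indices of the orbit of k, where X_i = C. *)
Lemma Re_gauss_period_bound (k : nat) : coprime p k -> p = (s * 2).+1 ->
  (2 * complex.Re (gauss_period k) + 1) ^+ 2 <= p%:R.
Proof.
move=> cpk ps; pose X i := complex.Re (gauss_period i); rewrite -/(X k).
set C := X k.
have Xmod i : X (i %% p)%N = X i.
  congr complex.Re; apply: eq_bigr => t _.
  by rewrite exprM (prim_expr_mod prim_w) -exprM.
have X2 i : X (i * 2)%N = X i.
  congr complex.Re; transitivity (\sum_(t < s) w ^+ (i * 2 ^ t.+1)).
    by apply: eq_bigr => t _; rewrite expnS mulnA.
  by rewrite (sum_shift (a := fun t => w ^+ (i * 2 ^ t))) // expr_order_of_2 muln1.
have X0 : X 0%N = s%:R.
  rewrite /X /gauss_period; under eq_bigr do rewrite mul0n expr0.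
  by rewrite sumr_const card_ord -(rmorph_nat (real_complex R)).
have sX : \sum_(i < p) X i = 0 by rewrite -Re_sum sum_gauss_period.
have sX2 : \sum_(i < p) X i ^+ 2 <= p%:R * s%:R.
  rewrite -sum_sqr_normc_gauss_period; apply: ler_sum => i _.
  by rewrite sqr_normcE lerDl sqr_ge0.
have := @le_sum_doubling_orbit R p p1 odd_p (fun i => (X i + 1 + C) ^+ 2) k cpk.
rewrite -/s X0 -/C => /(_ (fun i => sqr_ge0 _)) h.
have {h} := h (fun i => congr1 (fun y => (y + 1 + C) ^+ 2) (Xmod i))
   (fun i => congr1 (fun y => (y + 1 + C) ^+ 2) (X2 i)).
have -> : \sum_(i < p) (X i + 1 + C) ^+ 2 =
    \sum_(i < p) X i ^+ 2 + 2 * (1 + C) * \sum_(i < p) X i + p%:R * (1 + C) ^+ 2.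
  have -> : p%:R * (1 + C) ^+ 2 = \sum_(i < p) (1 + C) ^+ 2.
    by rewrite sumr_const card_ord mulr_natl.
  rewrite mulr_sumr -big_split /=.
  by rewrite -big_split /=; apply: eq_bigr => i _; ring.
rewrite sX mulr0 addr0 => h.
have {h} := le_trans h (lerD sX2 (lexx _)).
rewrite {1 2 3}ps -natr1 natrM => h.
have s0 : 0 < s%:R :> R by rewrite ltr0n; lia.
(* Cancelling [(1 + C) ^+ 2] and dividing by [s] leaves s + 2 (1 + C) + (2 C + 1) ^ 2 <= p + 2 (1 +
   C) ^ 2, and 2 C (1 + C) = ((2 C + 1) ^ 2 - 1) / 2. *)
rewrite -(ler_pM2l s0); lra.
Qed.

End GaussPeriods.

(** * Upper bounds for the eigenvalues *)

Section EigenvalueBounds.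
Variables (R : realType) (p : nat) (w : R[i]).
Hypotheses (p1 : (1 < p)%N) (odd_p : odd p) (prim_w : p.-primitive_root w).
Let s := order_of_2 p.

Definition rarefied_eigenvalue (k : nat) : R[i] :=
  \prod_(t < s) (1 - w ^+ (k * 2 ^ t)).

Lemma normc_prim_expr (m : nat) : normc (w ^+ m) = 1.
Proof.
apply: (normc_unity_root (prim_order_gt0 prim_w)).
by rewrite -exprM mulnC exprM (prim_expr_order prim_w) expr1n.
Qed.

Lemma order_of_2_gt0 : (0 < s)%N.
Proof. exact: order_gt0. Qed.

Lemma rarefied_eigenvalue0 (k : nat) : (p %| k)%N -> rarefied_eigenvalue k = 0.
Proof.
move=> pk; rewrite /rarefied_eigenvalue (bigD1 (Ordinal order_of_2_gt0)) //=.
have /eqP -> : w ^+ (k * 2 ^ 0) == 1 by rewrite muln1 -(prim_order_dvd prim_w).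
by rewrite subrr mul0r.
Qed.

(* The bound [1 + u <= exp (u - 2 / 7 * u ^ 2)], at [u = - Re x ^ (2 ^ t)],
   turns the product into [2 ^ s] times the exponential of a linear function of
   the Gauss gauss_period, because [2 * Re y ^ 2 = 1 + Re (y ^ 2)] on the unit circle. *)
Lemma sqr_normc_rarefied_eigenvalue_le (k : nat) :
  coprime p k -> p = (s * 2).+1 -> (40 <= s)%N ->
  normc (rarefied_eigenvalue k) ^+ 2 <= 2 ^+ s.
Proof.
move=> cpk ps s40.
pose c t := complex.Re (w ^+ (k * 2 ^ t)).
have cb t : -1 <= c t <= 1.
  rewrite -ler_norml -(@ler_pXn2r _ 2) ?nnegrE // real_normK ?num_real //.
  by rewrite expr1n -[leRHS](expr1n _ 2) -(normc_prim_expr (k * 2 ^ t)) sqr_normcE lerDl sqr_ge0.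
have cS t : c t ^+ 2 = (1 + c t.+1) / 2.
  have := Re_sqr (normc_prim_expr (k * 2 ^ t)).
  by rewrite -exprM -mulnA -expnSr -/(c t) -/(c t.+1) => ->; field.
have sc : \sum_(t < s) c t.+1 = \sum_(t < s) c t.
  by apply: sum_shift; rewrite /c expr_order_of_2 // muln1.
have cE : complex.Re (gauss_period p w k) = \sum_(t < s) c t by rewrite /gauss_period Re_sum.
have := Re_gauss_period_bound p1 odd_p prim_w cpk ps; rewrite cE => hC.
rewrite normc_prod -prodrXl.
apply: (@le_trans _ _ (\prod_(t < s) (2 * expR (- c t - 2 / 7 * (- c t) ^+ 2)))).
  apply: ler_prod => t _; rewrite sqr_ge0 sqr_normc_sub1 ?normc_prim_expr //=.
  have := @add1_le_expR_quadratic R (- c t).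
  have /andP[? ?] := cb t.
  have -> : -1 <= - c t <= 1 by apply/andP; split; lra.
  by move=> /(_ isT) h; rewrite -/(c t); lra.
rewrite big_split /= prodr_const card_ord -expR_sum.
rewrite -[leRHS]mulr1 ler_pM2l ?exprn_gt0 // -[leRHS]expR0 ler_expR.
under eq_bigr do rewrite sqrrN cS.
have -> : \sum_(t < s) (- c t - 2 / 7 * ((1 + c t.+1) / 2)) =
    - \sum_(t < s) c t - 1 / 7 * (s%:R + \sum_(t < s) c t.+1).
  have -> : s%:R = \sum_(t < s) (1 : R) by rewrite sumr_const card_ord.
  rewrite -big_split mulr_sumr -opprD -big_split /= -sumrN.
  by apply: eq_bigr => t _; field.
rewrite sc; move: hC; set C := \sum_(t < s) c t.
have : 40 <= s%:R :> R by rewrite ler_nat.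
have -> : p%:R = s%:R * 2 + 1 :> R by rewrite {1}ps -natr1 natrM.
(* The exponent is nonpositive when [C >= - s / 8]. The hypothesis [40 <= s] is exactly what the
   period bound requires: at [s = 40], (2 C + 1) ^ 2 <= 81 gives C >= -5. *)
move=> h40 hC; nra.
Qed.

Lemma sum_sqr_normc_rarefied_eigenvalue_ge (k : nat) : coprime p k ->
  s%:R * normc (rarefied_eigenvalue k) ^+ 2 <=
  \sum_(i < p) normc (rarefied_eigenvalue i) ^+ 2.
Proof.
move=> cpk.
pose F i := normc (rarefied_eigenvalue i) ^+ 2.
have Fmod i : F (i %% p)%N = F i.
  congr (normc _ ^+ 2); apply: eq_bigr => t _.
  by rewrite exprM (prim_expr_mod prim_w) -exprM.
have F2 i : F (i * 2)%N = F i.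
  rewrite /F; congr (_ ^+ 2).
  (* Doubling the index rotates the factors: the one for [t = s] equals the one for [t = 0]. *)
  have h : \prod_(t < s) (1 - w ^+ (i * 2 ^ t.+1)) = rarefied_eigenvalue i.
    have e : w ^+ (i * 2 ^ s) = w ^+ i := expr_order_of_2 p1 odd_p prim_w i.
    rewrite /rarefied_eigenvalue; move: (s) e => [|n] e.
      by rewrite !big_ord0.
    by rewrite big_ord_recr big_ord_recl /= mulrC e muln1.
  rewrite -h; congr normc; apply: eq_bigr => t _.
  by rewrite expnS mulnA.
have := @le_sum_doubling_orbit R p p1 odd_p F k cpk (fun i => sqr_ge0 _) Fmod F2.
by apply: le_trans; rewrite lerDr sqr_ge0.
Qed.

End EigenvalueBounds.

(** * Computing the mean square of the eigenvalues *)

(* Coefficients of the product by 1 - X ^ q modulo X ^ p - 1, for q < p. *)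
Definition mul_1subXn (p q : nat) (l : seq int) : seq int :=
  mkseq (fun i => l`_i - l`_((i + p - q) %% p)) p.

(** From [q = 1] and [[:: 1]], the constant polynomial 1 since missing entries read as 0, this gives
    G modulo X ^ p - 1 for [s > 0]. Reducing [q] at each step keeps all numbers small enough to
    compute with. *)
Fixpoint thue_morse_coefs (p s q : nat) (l : seq int) : seq int :=
  if s is s'.+1 then thue_morse_coefs p s' (q.*2 %% p) (mul_1subXn p q l) else l.

Definition sum_sqr_coefs (l : seq int) : nat :=
  sumn [seq (absz x * absz x)%N | x <- l].

Section ThueMorseCoefs.
Variables (F : comNzRingType) (p : nat) (x : F).
Hypotheses (p0 : (0 < p)%N) (xp1 : x ^+ p = 1).

Lemma eval_mul_1subXn (q : nat) (l : seq int) : (q < p)%N ->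
  \sum_(d < p) ((mul_1subXn p q l)`_d)%:~R * x ^+ d =
  (\sum_(d < p) (l`_d)%:~R * x ^+ d) * (1 - x ^+ q).
Proof.
move=> qp; rewrite mulrBr mulr1.
transitivity (\sum_(d < p) (l`_d)%:~R * x ^+ d
    - \sum_(d < p) (l`_(cyc_sub d (Ordinal qp)))%:~R * x ^+ d).
  rewrite -sumrB; apply: eq_bigr => d _.
  by rewrite nth_mkseq // rmorphB mulrBl.
congr (_ - _); rewrite mulr_suml [RHS](reindex_inj (@cyc_sub_inj _ (Ordinal qp))).
apply: eq_bigr => d _; rewrite -mulrA -exprD; congr (_ * _).
by rewrite -(expr_mod d xp1) -(expr_mod (_ + _) xp1) -(cyc_subP d (Ordinal qp)).
Qed.

Lemma eval_thue_morse_coefs (s q : nat) (l : seq int) : (q < p)%N ->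
  \sum_(d < p) ((thue_morse_coefs p s q l)`_d)%:~R * x ^+ d =
  (\sum_(d < p) (l`_d)%:~R * x ^+ d) * \prod_(t < s) (1 - x ^+ (q * 2 ^ t)).
Proof.
elim: s q l => [|s IH] q l qp /=; first by rewrite big_ord0 mulr1.
rewrite IH ?ltn_pmod // eval_mul_1subXn // -mulrA big_ord_recl muln1.
congr (_ * (_ * _)); apply: eq_bigr => t _; congr (1 - _).
rewrite -(expr_mod (_ * _) xp1) modnMml (expr_mod _ xp1).
by rewrite -muln2 -mulnA -expnS.
Qed.

End ThueMorseCoefs.

Lemma size_thue_morse_coefs (p s q : nat) (l : seq int) :
  (0 < s)%N -> size (thue_morse_coefs p s q l) = p.
Proof.
case: s => // s _; elim: s q l => [|s IH] q l; first by rewrite size_mkseq.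
by rewrite -[LHS]/(size (thue_morse_coefs p s.+1 _ _)) IH.
Qed.

(** Parseval's identity for G modulo X ^ p - 1, whose values at the powers of [w] are the
    eigenvalues. *)
Lemma sum_sqr_normc_rarefied_eigenvalue (R : realType) (p : nat) (w : R[i]) :
  (1 < p)%N -> p.-primitive_root w ->
  \sum_(k < p) normc (rarefied_eigenvalue p w k) ^+ 2 =
  p%:R * (sum_sqr_coefs (thue_morse_coefs p (order_of_2 p) 1 [:: 1]))%:R.
Proof.
move=> p1 prim_w; have p0 := ltnW p1.
set l := thue_morse_coefs _ _ _ _.
transitivity (p%:R * \sum_(d < p) normc ((l`_d)%:~R : R[i]) ^+ 2).
  rewrite -(parseval_normc _ prim_w); apply: eq_bigr => k _; congr (_ ^+ 2).
  congr normc; under [RHS]eq_bigr do rewrite mulnC exprM.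
  rewrite eval_thue_morse_coefs //; last first.
    by rewrite -exprM mulnC exprM (prim_expr_order prim_w) expr1n.
  rewrite (bigD1 (Ordinal p0)) //= expr0 mulr1 big1 ?addr0 ?mul1r.
    by apply: eq_bigr => t _; rewrite mul1n exprM.
  by case=> -[|[|d]] //= ? _; rewrite mul0r.
congr (_ * _); rewrite /sum_sqr_coefs sumnE big_map natr_sum.
rewrite (big_nth 0) (@size_thue_morse_coefs p) ?order_of_2_gt0 // big_mkord.
apply: eq_bigr => d _; rewrite -(rmorph_int (real_complex R)) sqr_normcE /=.
by rewrite expr0n addr0 natrM natr_absz intr_norm -normrM -expr2 ger0_norm ?sqr_ge0.
Qed.

(** 241 is the least integer whose product by 17 exceeds 16 * 2 ^ 8 = 4096, the bound to be
    contradicted. *)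
Lemma sum_sqr_coefs17 : (241 <= sum_sqr_coefs (thue_morse_coefs 17 8 1 [:: 1%R]))%N.
Proof. by vm_compute. Qed.

(* The product avoids a large unary numeral. *)
Lemma sum_sqr_coefs41 :
  (sum_sqr_coefs (thue_morse_coefs 41 20 1 [:: 1%R]) <= 400 * 1000)%N.
Proof. by vm_compute. Qed.

(** * The primes of [P21] below 81 *)

Lemma iter_double_mod (p k : nat) : (1 < p)%N ->
  iter k (fun x => x.*2 %% p)%N 1%N = (2 ^ k %% p)%N.
Proof.
move=> p1; elim: k => [|k IH]; first by rewrite modn_small.
by rewrite iterS IH -muln2 modnMml -expnSr.
Qed.

Lemma P21_order (p : nat) : P21 p -> p = (order_of_2 p * 2).+1.
Proof.
move=> [pr_p op _ ->]; have := prime_gt1 pr_p.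
by have := odd_double_half p; rewrite op; lia.
Qed.

(** Membership implies a condition on iterated doublings modulo [p], which an exhaustive search can
    evaluate without forming powers of 2. *)
Lemma P21_small (p : nat) : P21 p -> (p < 81)%N -> p = 17 \/ p = 41.
Proof.
move=> Pp lt_p; have ps := P21_order Pp.
case: Pp => pr_p op p4 os; have p1 := prime_gt1 pr_p.
pose pw k := iter k (fun x => x.*2 %% p)%N 1%N.
have pwE k : (pw k == 1%N) = (order_of_2 p %| k)%N.
  by rewrite /pw iter_double_mod // order_of_2_dvd // (modn_small p1).
have pw1 : pw (p.-1)./2 = 1%N by apply/eqP; rewrite pwE os.
have pw2 : all (fun k => pw k != 1%N) (iota 1 (p.-1)./2.-1).
  apply/allP => k; rewrite mem_iota pwE os => /andP[k0 k1].
  by rewrite gtnNdvd //; lia.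
have : all (fun p => [&& prime p, p %% 4 == 1,
    iter (p.-1)./2 (fun x => x.*2 %% p) 1 == 1 &
    all (fun k => iter k (fun x => x.*2 %% p) 1 != 1) (iota 1 (p.-1)./2.-1)]
    ==> (p \in [:: 17; 41]))%N (iota 0 81) by vm_compute.
move/allP/(_ p); rewrite mem_iota => /(_ lt_p).
rewrite pr_p p4 -/(pw _) pw1 pw2 /= !inE => /orP[]/eqP ->; by [left|right].
Qed.

(** * The largest modulus and the exponent [beta] *)

Section Lambda1.
Variables (R : realType) (p : nat) (w : R[i]).
Hypothesis (prim_w : p.-primitive_root w).
Let s := order_of_2 p.
Local Notation eigen := (rarefied_eigenvalue p w).

Lemma normc_le_lambda1 (k : 'I_p) : normc (eigen k) <= lambda1 R p.
Proof.
apply: ub_le_sup; last first.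
  by exists (eigen k) => //=; apply/(eigenvalue_rarefied_mx _ prim_w); exists k.
(* The supremum requires a bounded set; the sum of all the moduli bounds each of them. *)
exists (\sum_(i < p) normc (eigen i)) => _ [z /= Ez <-].
have /(eigenvalue_rarefied_mx _ prim_w)[i ->] := Ez.
by rewrite (bigD1 i) //= lerDl sumr_ge0 // => j _; exact: normc_ge0.
Qed.

Lemma lambda1_attained : exists k : 'I_p, lambda1 R p = normc (eigen k).
Proof.
pose k0 := Ordinal (prim_order_gt0 prim_w).
have [k _ kmax] := @arg_maxP _ _ _ k0 xpredT (fun k : 'I_p => normc (eigen k)) isT.
exists k; apply: le_anti; rewrite normc_le_lambda1 andbT.
apply: ge_sup.
  exists (normc (eigen k)), (eigen k) => //=.
  by apply/(eigenvalue_rarefied_mx _ prim_w); exists k.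
move=> _ [z /= Ez <-]; have /(eigenvalue_rarefied_mx _ prim_w)[i ->] := Ez.
exact: kmax.
Qed.

Lemma half_lt_beta : (1 / 2 < beta R p) = (2 ^+ s < lambda1 R p ^+ 2).
Proof.
have [k lk] := lambda1_attained.
have ln2 : 0 < ln 2 :> R by rewrite ln_gt0 // ltr1n.
have s0 : 0 < s%:R :> R by rewrite ltr0n order_of_2_gt0.
rewrite /beta -/s; have : 0 <= lambda1 R p by rewrite lk normc_ge0.
rewrite le_eqVlt => /orP[/eqP l0|l0].
  (* Since [ln 0] is 0 by convention, [beta] is 0 here and both inequalities are false. *)
  have -> : ln (lambda1 R p) = 0 by rewrite -l0 ln0.
  rewrite mul0r -l0 (expr2 (0 : R)) mulr0 [RHS]ltNge (ltW (exprn_gt0 _ _)) //=.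
  by apply/negbTE; rewrite -leNgt divr_ge0.
rewrite ltr_pdivlMr ?mulr_gt0 //.
have lnl : ln (lambda1 R p ^+ 2) = 2 * ln (lambda1 R p) by rewrite lnXn // mulr_natl.
have lns : ln (2 ^+ s) = s%:R * ln 2 :> R by rewrite lnXn // mulr_natl.
have s2 : (2 ^+ s : R) \is Num.pos by rewrite posrE exprn_gt0.
have l2 : lambda1 R p ^+ 2 \is Num.pos by rewrite posrE exprn_gt0.
by rewrite -(ltr_ln s2 l2) lnl lns; apply/idP/idP; lra.
Qed.

End Lambda1.

(** * The prime 17 and the conclusion *)

Lemma P21_17 : P21 17.
Proof.
(* The order divides 8 but not 4; writing these as powers of 2 leaves 8 as the only divisor
   possible. *)
split=> //; have : (order_of_2 17 %| 2 ^ 3)%N by rewrite order_of_2_dvd.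
have : ~~ (order_of_2 17 %| 2 ^ 2)%N by rewrite order_of_2_dvd.
move=> h4 /(dvdn_pfactor _ _ (isT : prime 2))[m le_m3 om].
rewrite om; move: h4; rewrite om dvdn_Pexp2l //.
by case: m le_m3 {om} => [|[|[|[|]]]].
Qed.

Theorem proposition5p6 (R : realType) :
  finite_set [set p | P21 p /\ 1 / 2 < beta R p] /\
  [set p | P21 p /\ 1 / 2 < beta R p] = [set 17%N].
Proof.
suff E : [set p | P21 p /\ 1 / 2 < beta R p] = [set 17%N].
  by split=> //; rewrite E; exact: finite_set1.
have o17 : order_of_2 17 = 8 by case: P21_17.
apply/seteqP; split=> [p /= [Pp]|_ /= ->].
  have [pr_p odd_p _ _] := Pp; have p1 := prime_gt1 pr_p; have ps := P21_order Pp.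
  have [w prim_w] := @exists_prim_root R[i] p pr_p.
  rewrite (half_lt_beta prim_w); have [k ->] := lambda1_attained prim_w.
  have [pk|npk] := boolP (p %| k)%N.
    rewrite rarefied_eigenvalue0 // ComplexField.Normc.normc0 (expr2 (0 : R)) mulr0.
    by rewrite ltNge (ltW (exprn_gt0 _ _)).
  have cpk : coprime p k by rewrite prime_coprime.
  have [p81|p81] := leqP 81 p.
    rewrite ltNge sqr_normc_rarefied_eigenvalue_le //.
    by move: p81; rewrite {1}ps; lia.
  have [//|p41] := P21_small Pp p81.
  subst p; have o41 : order_of_2 41 = 20 by case: Pp.
  have := sum_sqr_normc_rarefied_eigenvalue_ge p1 odd_p prim_w cpk.
  rewrite sum_sqr_normc_rarefied_eigenvalue // o41.
  have := sum_sqr_coefs41; rewrite -(ler_nat R) natrM.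
  move: (sum_sqr_coefs _)%:R (_ ^+ 2) => S N hS hN; rewrite ltNge => /negP[].
  (* Here 20 N <= 41 * 400000 gives N <= 820000, below 2 ^ 20 = 1048576. *)
  have -> : 2 ^+ 20 = 1024 * 1024 :> R by rewrite (exprD 2 10 10) -natrX.
  lra.
split; first exact: P21_17.
have [w prim_w] := @exists_prim_root R[i] 17 isT.
rewrite (half_lt_beta prim_w) o17 ltNge; apply/negP => l17.
have := sum_sqr_normc_rarefied_eigenvalue (isT : (1 < 17)%N) prim_w; rewrite o17.
have := sum_sqr_coefs17; rewrite -(ler_nat R).
move: (sum_sqr_coefs _)%:R => S hS eS.
(* The eigenvalue at index 0 vanishes, so only 16 terms remain, each at most 2 ^ 8 by [l17]. *)
have : 17 * S <= \sum_(k < 17 | k != ord0) 2 ^+ 8.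
  rewrite -eS (bigD1 ord0) //= rarefied_eigenvalue0 // ComplexField.Normc.normc0.
  rewrite (expr2 (0 : R)) mulr0 add0r; apply: ler_sum => k _; apply: le_trans l17.
  rewrite lerXn2r ?nnegrE ?normc_ge0 //; last exact: normc_le_lambda1.
  exact: le_trans (normc_ge0 _) (normc_le_lambda1 prim_w k).
rewrite sumr_const cardC1 card_ord -mulr_natr.
have -> : 2 ^+ 8 = 256 :> R by rewrite -natrX.
rewrite [17.-1]/=; lra.
Qed.
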